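(* Let $d\ge 1$ and let $\mathrm{E}:\mathbb{C}^{d\times d}\to\mathbb{R}$ be the function $\mathrm{E}(A)=\|AA^*-A^*A\|^2$. The only critical points of $\mathrm{E}$ are its global minima; that is, a matrix $A\in\mathbb{C}^{d\times d}$ is a critical point of $\mathrm{E}$ if and only if $A$ is normal.
   Context: $\mathbb{C}^{d\times d}$ is the space of complex $d\times d$ matrices, regarded as a real inner product space with $\langle A,B\rangle=\mathrm{Re}\,\mathrm{tr}(B^*A)$, where $A^*$ is the conjugate transpose. $\|\cdot\|$ is the Frobenius norm, $\|B\|^2=\sum_{i,j}|b_{ij}|^2$. A matrix $A$ is normal if $AA^*=A^*A$; the normal matrices are exactly the zeros (hence the global minima) of $\mathrm{E}$. A critical point of $\mathrm{E}$ is a point where its real derivative (equivalently, its gradient with respect to $\langle\cdot,\cdot\rangle$) vanishes. *)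

(* Defs.v *)
From HB Require Import structures.
From mathcomp Require Import all_boot all_order all_algebra.
From mathcomp Require Export complex.
From mathcomp Require Import spectral.
From mathcomp Require Import all_classical all_reals all_analysis.
From mathcomp Require Import ring lra.

Set Implicit Arguments.
Unset Strict Implicit.
Unset Printing Implicit Defensive.

Import Order.TTheory GRing.Theory Num.Theory.
Import numFieldNormedType.Exports.

Local Open Scope complex_scope.
Local Open Scope sesquilinear_scope.
Local Open Scope ring_scope.

(* The d x d complex matrices as a *real* normed space.  The alias is needed   *)
(* because 'M[R[i]]_d already carries its R[i]-module structure (and, in       *)
(* MathComp-Analysis, the topology of the max norm).                           *)
Definition Cmx (R : realType) (d : nat) : Type := 'M[R[i]]_d.

HB.instance Definition _ (R : realType) (d : nat) :=
  GRing.Zmodule.copy (Cmx R d) 'M[R[i]]_d.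

Section RealNormedSpace.
Variables (R : realType) (d : nat).
Implicit Types (a : R) (A B : Cmx R d).

Definition rscale a A : Cmx R d := a%:C *: (A : 'M[R[i]]_d).

Fact rscaleA a b A : rscale a (rscale b A) = rscale (a * b) A.
Proof. by rewrite /rscale rmorphM scalerA. Qed.

Fact rscale1 : left_id 1 rscale.
Proof. by move=> A; rewrite /rscale rmorph1 scale1r. Qed.

Fact rscaleDr : right_distributive rscale +%R.
Proof. by move=> a A B; rewrite /rscale scalerDr. Qed.

Fact rscaleDl A : {morph rscale^~ A : a b / a + b}.
Proof. by move=> a b; rewrite /rscale rmorphD scalerDl. Qed.

HB.instance Definition _ := GRing.Zmodule_isLmodule.Build R (Cmx R d)
  rscaleA rscale1 rscaleDr rscaleDl.

(* <A, B> = Re tr(B^* A); frobnormE says that frobnorm is its norm. *)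
Definition mxinner A B : R := complex.Re (\tr ((B : 'M[R[i]]_d)^t* *m A)).

Definition frobnorm A : R :=
  Num.sqrt (\sum_(i < d) \sum_(j < d) Normc.normc (A i j) ^+ 2).

Fact mxinnerE A B : mxinner A B =
  \sum_i \sum_j (complex.Re (A i j) * complex.Re (B i j)
    + complex.Im (A i j) * complex.Im (B i j)).
Proof.
rewrite /mxinner /mxtrace (raddf_sum (@complex.Re R)) exchange_big /=.
apply: eq_bigr => j _; rewrite mxE (raddf_sum (@complex.Re R)) /=.
apply: eq_bigr => i _; rewrite !mxE.
by case: (A i j) (B i j) => [a b] [x y] /=; ring.
Qed.

Fact frobnormE A : frobnorm A = Num.sqrt (mxinner A A).
Proof.
rewrite /frobnorm mxinnerE; congr Num.sqrt.
apply: eq_bigr => i _; apply: eq_bigr => j _.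
case: (A i j) => a b /=.
by rewrite sqr_sqrtr ?addr_ge0 ?sqr_ge0// -!expr2.
Qed.

Fact mxinnerC A B : mxinner A B = mxinner B A.
Proof.
by rewrite !mxinnerE; apply: eq_bigr => i _; apply: eq_bigr => j _; ring.
Qed.

Fact mxinnerDl A B C : mxinner (A + B) C = mxinner A C + mxinner B C.
Proof.
rewrite !mxinnerE -big_split; apply: eq_bigr => i _ /=.
rewrite -big_split; apply: eq_bigr => j _ /=.
by rewrite mxE !raddfD /=; ring.
Qed.

Fact mxinnerZl a A B : mxinner (a *: A) B = a * mxinner A B.
Proof.
rewrite !mxinnerE mulr_sumr; apply: eq_bigr => i _ /=.
rewrite mulr_sumr; apply: eq_bigr => j _ /=.
by rewrite mxE; case: (A i j) => x y /=; ring.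
Qed.

Fact mxinner_ge0 A : 0 <= mxinner A A.
Proof.
rewrite mxinnerE; apply: sumr_ge0 => i _; apply: sumr_ge0 => j _.
by rewrite addr_ge0 // -expr2 sqr_ge0.
Qed.

Fact frobnorm_eq0 A : frobnorm A = 0 -> A = 0.
Proof.
rewrite /frobnorm => /eqP; rewrite sqrtr_eq0 => le0.
have ge0 i j : 0 <= Normc.normc (A i j) ^+ 2 by exact: sqr_ge0.
have ge0' i : 0 <= \sum_j Normc.normc (A i j) ^+ 2 by exact: sumr_ge0.
have /eqP: \sum_i \sum_j Normc.normc (A i j) ^+ 2 == 0.
  by rewrite eq_le le0 sumr_ge0.
move=> /psumr_eq0P h; apply/matrixP => i j; rewrite mxE.
have /psumr_eq0P h' := h (fun i _ => ge0' i) i isT.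
by apply: Normc.eq0_normc; apply/eqP; rewrite -sqrf_eq0 (h' (fun j _ => ge0 i j)).
Qed.

Fact mxinner_CauchySchwarz A B :
  mxinner A B ^+ 2 <= mxinner A A * mxinner B B.
Proof.
have [B0|B_gt0] := leP (mxinner B B) 0.
  have -> : B = 0 by apply: frobnorm_eq0; rewrite frobnormE ler0_sqrtr.
  rewrite mxinnerC -[0 : Cmx R d](scale0r (0 : Cmx R d)) mxinnerZl mul0r.
  by rewrite expr0n /= mulr_ge0 ?mxinner_ge0.
have := mxinner_ge0 (mxinner B B *: A + (- mxinner A B) *: B).
rewrite !(mxinnerDl, mxinnerZl) !(mxinnerC _ (_ + _)).
rewrite !(mxinnerDl, mxinnerZl) (mxinnerC B A) => h.
rewrite -subr_ge0 -(pmulr_rge0 _ B_gt0).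
by apply: le_trans h _; rewrite le_eqVlt; apply/orP; left; apply/eqP; ring.
Qed.

Fact frobnormD A B : frobnorm (A + B) <= frobnorm A + frobnorm B.
Proof.
rewrite -ler_sqr ?nnegrE ?addr_ge0 ?sqrtr_ge0 // !frobnormE sqrrD.
rewrite !sqr_sqrtr ?mxinner_ge0 // mxinnerDl !(mxinnerC _ (_ + _)) !mxinnerDl.
rewrite (mxinnerC B A) -sqrtrM ?mxinner_ge0 //.
have : mxinner A B <= Num.sqrt (mxinner A A * mxinner B B).
  by rewrite (le_trans (ler_norm _)) // -sqrtr_sqr ler_wsqrtr // mxinner_CauchySchwarz.
by rewrite mulr2n; lra.
Qed.

Fact frobnormZ a A : frobnorm (a *: A) = `|a| * frobnorm A.
Proof.
rewrite !frobnormE mxinnerZl mxinnerC mxinnerZl mulrA -expr2.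
by rewrite sqrtrM ?sqr_ge0 // sqrtr_sqr.
Qed.

HB.instance Definition _ := Lmodule_isNormed.Build R (Cmx R d)
  frobnormD frobnormZ frobnorm_eq0.

End RealNormedSpace.

Definition energy (R : realType) (d : nat) (A : Cmx R d) : R :=
  frobnorm (A *m A^t* - A^t* *m A) ^+ 2.

(* [is_diff x f df] says that f is (Frechet) differentiable at x with          *)
(* differential df.                                                            *)
Definition critical_point (R : realType) (V : normedModType R)
    (f : V -> R) (x : V) : Prop :=
  is_diff x f (cst 0).

Definition global_minimum (R : realType) (T : Type) (f : T -> R) (x : T) : Prop :=
  forall y, f x <= f y.

(* Main.v *)
(* [energy] is homogeneous of degree 4, so by Euler's relation its derivative at
   [A] in the direction [A] is [4 * energy A]; a critical point therefore has
   zero energy, that is, is normal.  Conversely, at a normal [A] the commutator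
   of [A + h] with its adjoint has norm [O(|h|)], so
   [energy (A + h) = O(|h| ^+ 2)] and the differential of [energy] vanishes. *)

Require Import Defs.
From mathcomp Require Import all_boot all_order all_algebra spectral.
From mathcomp Require Import all_classical all_reals all_analysis.
From mathcomp Require Import ring lra.

Import Order.TTheory GRing.Theory Num.Theory.
Import numFieldNormedType.Exports.

Local Open Scope complex_scope.
Local Open Scope sesquilinear_scope.
Local Open Scope ring_scope.

Lemma frobnorm_sqr {R : realType} {d : nat} (A : Cmx R d) :
  frobnorm A ^+ 2 = \sum_i \sum_j Normc.normc (A i j) ^+ 2.
Proof.
by rewrite sqr_sqrtr// !sumr_ge0// => i _; rewrite sumr_ge0// => j _; apply: sqr_ge0.
Qed.

Lemma normc_conj {R : rcfType} (x : R[i]) : Normc.normc x^* = Normc.normc x.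
Proof. by case: x => a b; rewrite /= sqrrN. Qed.

Lemma frobnorm_adj {R : realType} {d : nat} (A : Cmx R d) :
  frobnorm (A^t* : Cmx R d) = frobnorm A.
Proof.
rewrite /frobnorm exchange_big; congr Num.sqrt.
by apply: eq_bigr => i _; apply: eq_bigr => j _; rewrite !mxE normc_conj.
Qed.

(** Cauchy-Schwarz for the Hermitian form [dotmx], applied to row [i] of [A] and the adjoint of
    column [j] of [B]. Summed over [i] and [j], it makes the Frobenius norm submultiplicative. *)
Lemma normc_mulmx_sqr {R : rcfType} {m n p : nat}
    (A : 'M[R[i]]_(m, n)) (B : 'M[R[i]]_(n, p)) (i : 'I_m) (j : 'I_p) :
  Normc.normc ((A *m B) i j) ^+ 2 <=
  (\sum_k Normc.normc (A i k) ^+ 2) * (\sum_k Normc.normc (B k j) ^+ 2).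
Proof.
pose u := row i A; pose v := (col j B)^t*.
have dotE (w : 'rV[R[i]]_n) :
    dotmx w w = (\sum_k Normc.normc (w 0 k) ^+ 2)%:C.
  rewrite dotmxE mxE rmorph_sum; apply: eq_bigr => k _ /=.
  by rewrite !mxE rmorphXn /= -sqr_normc.
have : `|dotmx u v| ^+ 2 <= dotmx u u * dotmx v v.
  exact: (CauchySchwarz (@dotmx _ n) u v).1.
have -> : dotmx u v = (A *m B) i j.
  by rewrite dotmxE trmxCK !mxE; apply: eq_bigr => k _; rewrite !mxE.
rewrite !dotE -rmorphM -[`|_|]/((Normc.normc _)%:C) -rmorphXn lecR /=.
congr (_ <= _ * _); apply: eq_bigr => k _; rewrite !mxE// normc_conj//.
Qed.

Lemma frobnormM {R : realType} {d : nat} (A B : Cmx R d) :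
  frobnorm (A *m B : Cmx R d) <= frobnorm A * frobnorm B.
Proof.
rewrite -ler_sqr ?nnegrE ?mulr_ge0 ?sqrtr_ge0// exprMn !frobnorm_sqr.
rewrite [X in _ * X]exchange_big mulr_suml ler_sum// => i _.
by rewrite mulr_sumr ler_sum// => j _; exact: normc_mulmx_sqr.
Qed.

(** A quadratic bound makes the increment of [f] a little-o of [h]; uniqueness of the differential
    then forces it to be zero. *)
Lemma is_diff_quadratic {R : realType} {V : normedModType R}
    (f : V -> R) (x : V) (k : R) :
  (\forall h \near (0 : V), `|f (h + x) - f x| <= k * `|h| ^+ 2) ->
  is_diff x f (cst 0).
Proof.
move=> fk.
have fo : f \o shift x = cst (f x) + cst 0 +o_ 0 (@id V).
  apply/eqaddoP => _/posnumP[e].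
  (* Whatever the sign of [k], [|k| + 1] is positive and bounds [k] from above. *)
  have e'0 : 0 < e%:num / (`|k| + 1) by rewrite divr_gt0// ltr_wpDl.
  near=> h; rewrite /= !fctE addr0.
  have hfk : `|f (h + x) - f x| <= k * `|h| ^+ 2 by near: h.
  apply: (le_trans hfk); rewrite expr2 mulrA ler_wpM2r//.
  have he : `|h| < e%:num / (`|k| + 1).
    by near: h; apply/nbhs_norm0P; exists (e%:num / (`|k| + 1)).
  rewrite ltr_pdivlMr ?ltr_wpDl// in he.
  apply: le_trans (ltW he); rewrite mulrC ler_wpM2l//.
  by rewrite (le_trans (ler_norm _))// lerDl.
have dE : 'd f x = cst 0 :> (V -> R).
  apply: (@diff_unique _ _ _ f (\0%R : {linear V -> R})) => //.
  exact: cst_continuous.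
apply: DiffDef => //; apply/diff_locallyP; rewrite dE; split=> //.
exact: cst_continuous.
Unshelve. all: by end_near. Qed.

(* Euler's relation: along the ray [t *: x], [f] equals [t ^+ n.+1 * f x], whose
   derivative at [t = 1] is [n.+1%:R * f x]. *)
Lemma homogeneous_is_diff0_eq0 {R : numFieldType} {V : normedModType R}
    (f : V -> R) (n : nat) (x : V) :
  (forall t y, f (t *: y) = t ^+ n.+1 * f y) -> is_diff x f (cst 0) -> f x = 0.
Proof.
move=> fh fx.
(* The normed structure of [R] is spelled out because unification does not
   otherwise identify it with the one in [is_diff_scalel]. *)
have d0 : @is_diff_def R R R (nbhs_filter_on (1 : R)) (Phantom _ (nbhs (1 : R)))
    (f \o ( *:%R^~ x)) (cst 0 \o ( *:%R^~ x)).
  refine (is_diff_comp (@is_diff_scalel R V 1 x) _).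
  by rewrite scale1r.
have fE : f \o ( *:%R^~ x) = f x *: (@id R) ^+ n.+1.
  by apply/funext => t /=; rewrite fh fctE mulrC.
rewrite fE in d0.
have d1 : is_diff (1 : R) (f x *: (@id R) ^+ n.+1)
    (f x *: (n.+1%:R * 1 ^+ n *: id)).
  exact: (is_diffZ _ (@is_diffX R R id id n 1 (@is_diff_id R R 1))).
(* Both differentials belong to the same function of [t]; they are compared in the direction [1]. *)
have := @diff_val _ _ _ _ _ _ _ d1; rewrite (@diff_val _ _ _ _ _ _ _ d0).
move=> /(congr1 (@^~ 1)); rewrite !fctE /= expr1n mulr1 => /esym/eqP.
by rewrite !scaler_eq0 oner_eq0 pnatr_eq0 !orbF => /eqP.
Qed.

Lemma frobnorm_commutator {R : realType} {d : nat} (A B : Cmx R d) :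
  frobnorm (A *m B - B *m A : Cmx R d) <= 2 * frobnorm A * frobnorm B.
Proof.
have AB : `|A *m B : Cmx R d| <= frobnorm A * frobnorm B := frobnormM A B.
have BA : `|B *m A : Cmx R d| <= frobnorm B * frobnorm A := frobnormM B A.
have := ler_normB (A *m B : Cmx R d) (B *m A).
by move=> /le_trans; apply; lra.
Qed.

(** A real scalar is fixed by conjugation, so it leaves the commutator as [t ^+ 2]; the squared norm
    doubles the exponent. *)
Lemma energyZ {R : realType} {d : nat} (t : R) (A : Cmx R d) :
  energy (t *: A) = t ^+ 4 * energy A.
Proof.
rewrite /energy.
have -> : (t *: A) *m (t *: A : Cmx R d)^t*
    - (t *: A : Cmx R d)^t* *m (t *: A) =
    t ^+ 2 *: (A *m A^t* - A^t* *m A : Cmx R d).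
  rewrite -[t *: A]/(t%:C *: (A : 'M[R[i]]_d)).
  have -> : (t%:C *: (A : 'M[R[i]]_d))^t* = t%:C *: A^t*.
    apply/matrixP => i j; rewrite !mxE rmorphM /=.
    by congr (_ * _); exact: conjc_real.
  rewrite -!scalemxAl -!scalemxAr !scalerA -scalerBr.
  rewrite -[RHS]/((t ^+ 2)%:C *: (_ : 'M[R[i]]_d)).
  by rewrite -rmorphM -expr2.
by rewrite frobnormZ exprMn -normrX ger0_norm ?sqr_ge0// -exprM.
Qed.

Lemma energy_eq0 {R : realType} {d : nat} (A : Cmx R d) :
  energy A = 0 <-> A \is normalmx.
Proof.
split=> [/eqP|/normalmxP An]; last first.
  rewrite /energy An subrr -[frobnorm _]/(`|0 : Cmx R d|).
  by rewrite normr0 expr0n.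
rewrite sqrf_eq0 => /eqP /frobnorm_eq0 /eqP.
by rewrite subr_eq0 => /eqP An; apply/normalmxP.
Qed.

Lemma normal_critical_point {R : realType} {d : nat} (A : Cmx R d) :
  A \is normalmx -> critical_point (@energy R d) A.
Proof.
(* Each of the two commutators linear in [h] contributes [2 * frobnorm A] to the constant. The
   quadratic one contributes [2], since [b * b <= b] for [b = frobnorm h < 1]. *)
move=> An; apply: (is_diff_quadratic _ _ ((4 * frobnorm A + 2) ^+ 2)).
rewrite (energy_eq0 A).2//; near=> h.
have : `|h| < 1 by near: h; apply/nbhs_norm0P; exists 1 => /=.
rewrite -[`|h|]/(frobnorm h) => h1.
rewrite subr0 ger0_norm ?sqr_ge0// -exprMn ler_sqr ?nnegrE; last 2 first.
- exact: sqrtr_ge0.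
- by rewrite mulr_ge0 ?addr_ge0 ?mulr_ge0 ?sqrtr_ge0.
(* Normality of [A] cancels the term of degree zero in [h]. *)
have -> : (h + A) *m (h + A)^t* - (h + A)^t* *m (h + A) =
    (h *m A^t* - A^t* *m h : Cmx R d) + (A *m h^t* - h^t* *m A : Cmx R d)
    + (h *m h^t* - h^t* *m h : Cmx R d).
  have /normalmxP AA := An.
  have -> : (h + A)^t* = h^t* + A^t*.
    by apply/matrixP => i j; rewrite !mxE rmorphD.
  rewrite !(mulmxDl, mulmxDr) AA.
  (* The products are generalized so that [ring] sees their entries as atoms. *)
  move: (h *m h^t*) (h *m A^t*) (A *m h^t*) (h^t* *m h) (h^t* *m A)
    (A^t* *m h) (A^t* *m A).
  by move=> *; apply/matrixP => i j; rewrite !mxE; ring.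
apply: le_trans (frobnormD _ _) _.
apply: le_trans (lerD (frobnormD _ _) (lexx _)) _.
apply: le_trans (lerD (lerD (frobnorm_commutator _ _)
  (frobnorm_commutator _ _)) (frobnorm_commutator _ _)) _.
rewrite !frobnorm_adj -[leRHS]/((4 * frobnorm A + 2) * frobnorm h).
have : 0 <= frobnorm h by exact: sqrtr_ge0.
move: h1; move: (frobnorm h) (frobnorm A) => b a b1 b0.
have : b * b <= b by rewrite ler_piMr// ltW.
lra.
Unshelve. all: by end_near. Qed.

Theorem theorem2p3 (R : realType) (d : nat) (hd : (1 <= d)%N) (A : Cmx R d) :
  (critical_point (@energy R d) A <-> global_minimum (@energy R d) A) /\
  (critical_point (@energy R d) A <-> A \is normalmx).
Proof.
have critE : critical_point (@energy R d) A <-> A \is normalmx.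
  split=> [Acrit|]; last exact: normal_critical_point.
  apply/energy_eq0; apply: homogeneous_is_diff0_eq0 Acrit => t B.
  exact: energyZ.
have minE : global_minimum (@energy R d) A <-> energy A = 0.
  split=> [/(_ 0)|EA B]; last by rewrite EA; exact: sqr_ge0.
  (* Writing [0] as [0 *: 0] lets homogeneity give [energy 0 = 0], so a global minimum has energy at
     most zero. *)
  rewrite -(scale0r (0 : Cmx R d)) energyZ expr0n mul0r => E_le0.
  by apply/eqP; rewrite eq_le E_le0 sqr_ge0.
split=> //; apply: iff_trans critE _; apply: iff_sym.
exact: iff_trans minE (energy_eq0 A).
Qed.
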